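(* Let $\mathcal{L}$ be a sorted, possibly infinitary first-order signature, $\mathcal{C}$ a (not necessarily full) subcategory of $\text{Str}\,\mathcal{L}$, and $\mathcal{K}$ a subcategory of $\mathcal{C}$. Suppose $\kappa$ is a regular uncountable cardinal such that $\kappa>|\mathcal{L}|$ and $\mu^{<\text{ar}(\mathcal{L})}<\kappa$ for all $\mu<\kappa$. Let $\lambda$ be a (not necessarily regular) cardinal such that: (i) $\lambda^{<\kappa}=\lambda$; (ii) $\mathcal{K}$ has the $\lambda$-Uniformly Stationary LS Property; (iii) $\mathcal{C}$ has the $<\kappa$-Uniformly Stationary LS Property with factoring through $\mathcal{K}$; that is, $\mathcal{C}$ has pushouts, and $\mathcal{C}$ has the LS Property on a stationary class $\Gamma\subset[V]^{<\kappa}$ of $\mathcal{C}$-appropriate $\mathfrak{N}$ such that, for every $\mathfrak{N}\in\Gamma$, whenever $f\in\mathfrak{N}\cap\text{Mor}\,\mathcal{K}$, the two maps $\widetilde{f\restriction\mathfrak{N}}^{\ \mathcal{C}}$ and $f/^{\mathcal{C}}\mathfrak{N}$ lie in $\mathcal{K}$; (iv) the arrow category $\mathcal{K}^{\to}$ is closed under isomorphisms in the arrow category $\mathcal{C}^{\to}$; i.e., for every commutative square in $\mathcal{C}$ whose two vertical arrows are $\mathcal{C}$-isomorphisms, the top arrow is in $\mathcal{K}$ if and only if the bottom arrow is in $\mathcal{K}$. Then $\mathcal{K}$ is $\lambda$-stable.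
   Context: **Signatures.** $\text{Str}\,\mathcal{L}$ is the category of $\mathcal{L}$-structures and $\mathcal{L}$-homomorphisms. $|\mathcal{L}|$ is the number of $\mathcal{L}$-symbols; $\text{ar}(\mathcal{L})$ is the least infinite regular cardinal strictly bounding all arities of symbols of $\mathcal{L}$. **Stationarity.** $V$ is the universe of sets; a set $N$ is identified with $\mathfrak{N}=(N,\in)$, and $\prec_1$ means $\Sigma_1$-elementarity. $[V]^{<\kappa}$ is the class of sets of size $<\kappa$. A class $\Gamma\subseteq[V]^{<\kappa}$ is stationary in $[V]^{<\kappa}$ ($\kappa$ regular uncountable) if for every set $P$ with $|P|<\kappa$ there is $N\in\Gamma$ with $P\subset\mathfrak{N}\prec_1(V,\in)$ and $N\cap\kappa$ an ordinal. $N$ is $<\rho$-closed if every subset of $N$ of size $<\rho$ is an element of $N$. **Appropriate sets.** $\mathfrak{N}$ is $\mathcal{L}$-appropriate if $\mathcal{L}\cup\{\mathcal{L}\}\subset\mathfrak{N}\prec_1(V,\in)$ and $\mathfrak{N}$ is $<\text{ar}(\mathcal{L})$-closed. For an $\mathcal{L}$-homomorphism $f:A\to B$, ''$f\in\mathfrak{N}$'' means $f$ (as a set of ordered pairs), $A$ and $B$ are all elements of $\mathfrak{N}$. In that case $\mathfrak{N}\cap A$, $\mathfrak{N}\cap B$ are $\mathcal{L}$-substructures of $A,B$ and $f$ restricts to an $\mathcal{L}$-homomorphism $f\restriction\mathfrak{N}:\mathfrak{N}\cap A\to\mathfrak{N}\cap B$. Let $\mathcal{S}(\text{Str}\,\mathcal{L},f,\mathfrak{N})$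 be the commutative square with top arrow $f$, bottom arrow $f\restriction\mathfrak{N}$ and vertical arrows the inclusions $\mathfrak{N}\cap A\subset A$, $\mathfrak{N}\cap B\subset B$. **LS Property.** For a subcategory $\mathcal{K}$ of $\text{Str}\,\mathcal{L}$, $\mathfrak{N}$ is $\mathcal{K}$-appropriate if it is $\mathcal{L}$-appropriate and for every $f\in\mathfrak{N}\cap\text{Mor}\,\mathcal{K}$ all objects and arrows of $\mathcal{S}(\text{Str}\,\mathcal{L},f,\mathfrak{N})$ are in $\mathcal{K}$. $\mathcal{K}$ has the LS Property on a class $\Gamma$ of $\mathcal{L}$-appropriate structures if every member of $\Gamma$ is $\mathcal{K}$-appropriate. $\mathcal{K}$ has the $<\kappa$-Uniformly Stationary LS Property if it has the LS Property on some stationary subclass of $[V]^{<\kappa}$; for infinite $\lambda$, the $\lambda$-Uniformly Stationary LS Property is the $<\lambda^+$-Uniformly Stationary LS Property. **Pushout maps.** Suppose $\mathcal{C}$ has pushouts (not assumed to agree with those of $\text{Str}\,\mathcal{L}$), $\mathfrak{N}$ is $\mathcal{C}$-appropriate and $f:A\to B$ is in $\mathfrak{N}\cap\text{Mor}\,\mathcal{C}$. Let $P=P(\mathcal{C},f,\mathfrak{N})$ be the $\mathcal{C}$-pushout of the span $A\supseteq\mathfrak{N}\cap A\xrightarrow{f\restriction\mathfrak{N}}\mathfrak{N}\cap B$. Then $\widetilde{f\restriction\mathfrak{N}}^{\ \mathcal{C}}:A\to P$ is the pushout of $f\restriction\mathfrak{N}$ (the canonical map from $A$), and $f/^{\mathcal{C}}\mathfrak{N}:P\to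 B$ is the unique $\mathcal{C}$-morphism induced by $f:A\to B$ and the inclusion $\mathfrak{N}\cap B\subset B$. **Stability.** For $\mathcal{K}$-morphisms $f:A\to B$, $g:A\to C$ and $b\in B$, $c\in C$, put $(b,f)\sim_{\text{atomic}}(c,g)$ if there are $\mathcal{K}$-morphisms $g':B\to D$, $f':C\to D$ with $g'f=f'g$ and $g'(b)=f'(c)$. Let $\sim$ be the equivalence relation generated by $\sim_{\text{atomic}}$; $\text{gS}^1(A)$ is the collection of $\sim$-classes of pairs $(b,f)$ with $\text{dom}(f)=A$. $\mathcal{K}$ is $\lambda$-stable if $|\text{gS}^1(A)|\le\lambda$ for every $\mathcal{K}$-object $A$ with $|A|=\lambda$. Morphisms are not assumed to be monomorphisms.
   Formalization: It is additionally assumed that every L-isomorphism between two objects of C is a morphism of C; without this the claim fails, e.g. for C = K = sets with inclusions as the only morphisms, κ = ω₁, λ = 2^ω, where gS¹(A) is a proper class. *)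

(* Defs.v *)
(* Set theory is axiomatised: [universe] is a model (V, ∈) of ZFC
   whose proper classes are arbitrary Rocq predicates on V. *)
From Stdlib Require Import Relations.

Set Implicit Arguments.
Unset Strict Implicit.
Unset Printing Implicit Defensive.

(** * The universe of sets *)

(* The set-forming operations are functions of V.  By extensionality they are
   determined by their axioms, except for [inf], of which only the least
   inductive subset is used. *)
Record universe : Type := Universe {
  set_of :> Type;
  mem : set_of -> set_of -> Prop;
  empty : set_of;
  upair : set_of -> set_of -> set_of;
  union : set_of -> set_of;
  power : set_of -> set_of;
  inf : set_of;
  repl : (set_of -> set_of -> Prop) -> set_of -> set_of;
  extensionality : forall x y, (forall z, mem z x <-> mem z y) -> x = y;
  foundation : forall x, (exists y, mem y x) ->
    exists y, mem y x /\ ~ exists z, mem z y /\ mem z x;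
  mem_empty : forall x, ~ mem x empty;
  mem_upair : forall a b x, mem x (upair a b) <-> x = a \/ x = b;
  mem_union : forall a x, mem x (union a) <-> exists y, mem x y /\ mem y a;
  mem_power : forall a x, mem x (power a) <-> forall z, mem z x -> mem z a;
  mem_inf : mem empty inf /\
    forall x, mem x inf -> mem (union (upair x (upair x x))) inf;
  mem_repl : forall (R : set_of -> set_of -> Prop) a,
    (forall x y y', mem x a -> R x y -> R x y' -> y = y') ->
    forall y, mem y (repl R a) <-> exists x, mem x a /\ R x y;
  choice : forall a,
    (forall x, mem x a -> exists z, mem z x) ->
    (forall x y z, mem x a -> mem y a -> mem z x -> mem z y -> x = y) ->
    exists c, forall x, mem x a -> exists! z, mem z x /\ mem z c
}.

Arguments mem {u}.
Arguments empty {u}.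
Arguments upair {u}.
Arguments union {u}.
Arguments power {u}.
Arguments inf {u}.
Arguments repl {u}.

Notation "x ∈ y" := (mem x y) (at level 70, no associativity).

Section SetTheory.
Variable V : universe.
Implicit Types (a b f g x y : V).

Definition subset x y : Prop := forall z, z ∈ x -> z ∈ y.

Definition sep x (P : V -> Prop) : V := repl (fun z y => z = y /\ P z) x.

(* Definite description: the unique set satisfying P, if there is one. *)
Definition the (P : V -> Prop) : V :=
  union (repl (fun _ y => P y) (upair empty empty)).

Definition sing x : V := upair x x.
Definition cup x y : V := union (upair x y).
Definition cap x y : V := sep x (fun z => z ∈ y).
Definition succ x : V := cup x (sing x).
Definition opair a b : V := upair (sing a) (upair a b).
Definition prod x y : V :=
  sep (power (power (cup x y)))
      (fun p => exists a b, a ∈ x /\ b ∈ y /\ p = opair a b).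

Definition dom f : V := sep (union (union f)) (fun a => exists b, opair a b ∈ f).
Definition ran f : V := sep (union (union f)) (fun b => exists a, opair a b ∈ f).
Definition app f a : V := the (fun b => opair a b ∈ f).
Definition func f x y : Prop :=
  subset f (prod x y) /\ forall a, a ∈ x -> exists! b, opair a b ∈ f.

(* [idmap x] is also the graph of the inclusion of x in any larger set. *)
Definition idmap x : V := sep (prod x x) (fun p => exists a, p = opair a a).
Definition comp g f : V :=
  sep (prod (dom f) (ran g))
      (fun p => exists a b c, p = opair a c /\ opair a b ∈ f /\ opair b c ∈ g).
Definition restrict f x : V :=
  sep f (fun p => exists a b, p = opair a b /\ a ∈ x).

Definition injective f : Prop :=
  forall a a' b, opair a b ∈ f -> opair a' b ∈ f -> a = a'.
Definition surjective f y : Prop := forall b, b ∈ y -> exists a, opair a b ∈ f.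

(** ** Ordinals and cardinals *)

Definition is_ordinal x : Prop :=
  (forall y, y ∈ x -> subset y x) /\
  (forall y z, y ∈ x -> z ∈ x -> y ∈ z \/ y = z \/ z ∈ y).

Definition inductive_set x : Prop :=
  empty ∈ x /\ forall n, n ∈ x -> succ n ∈ x.
Definition omega : V := sep inf (fun n => forall x, inductive_set x -> n ∈ x).

Definition card_le x y : Prop := exists f, func f x y /\ injective f.
Definition card_lt x y : Prop := card_le x y /\ ~ card_le y x.
Definition card_eq x y : Prop :=
  exists f, func f x y /\ injective f /\ surjective f y.

Definition is_cardinal k : Prop :=
  is_ordinal k /\ forall x, x ∈ k -> ~ card_le k x.
Definition is_infinite_cardinal k : Prop := is_cardinal k /\ subset omega k.
Definition is_regular k : Prop :=
  is_infinite_cardinal k /\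
  forall x f, x ∈ k -> func f x k ->
    exists b, b ∈ k /\ forall i, i ∈ x -> app f i ∈ b.
Definition is_uncountable k : Prop := card_lt omega k.
Definition is_succ_cardinal l l' : Prop :=
  is_cardinal l' /\ l ∈ l' /\
  forall m, is_cardinal m -> l ∈ m -> subset l' m.

(* The set of all functions from an ordinal < k to l: its cardinality is l^{<k}. *)
Definition lt_sequences l k : V :=
  sep (power (prod k l)) (fun f => exists i, i ∈ k /\ func f i l).

(** ** Σ₁-elementarity *)

(* De Bruijn variables.  [BEx i φ] is ∃x∈v_i φ, [Ex φ] is ∃x φ, where x becomes
   variable 0 of φ. *)
Inductive delta0 : Type :=
| Mem (i j : nat)
| Eq (i j : nat)
| Not (p : delta0)
| And (p q : delta0)
| BEx (i : nat) (p : delta0).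

Inductive sigma1 : Type :=
| Delta0 (p : delta0)
| Ex (p : sigma1).

Definition push x (e : nat -> V) (n : nat) : V :=
  match n with O => x | S m => e m end.

(* Satisfaction in the structure (D, ∈). *)
Fixpoint sat0 (D : V -> Prop) (e : nat -> V) (p : delta0) : Prop :=
  match p with
  | Mem i j => e i ∈ e j
  | Eq i j => e i = e j
  | Not q => ~ sat0 D e q
  | And q r => sat0 D e q /\ sat0 D e r
  | BEx i q => exists x, D x /\ x ∈ e i /\ sat0 D (push x e) q
  end.

Fixpoint sat1 (D : V -> Prop) (e : nat -> V) (p : sigma1) : Prop :=
  match p with
  | Delta0 q => sat0 D e q
  | Ex q => exists x, D x /\ sat1 D (push x e) q
  end.

Definition sigma1_elementary (N : V) : Prop :=
  (exists x, x ∈ N) /\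
  forall (p : sigma1) (e : nat -> V), (forall i, e i ∈ N) ->
    (sat1 (fun x => x ∈ N) e p <-> sat1 (fun _ => True) e p).

(** ** Stationary classes *)

Definition stationary (k : V) (G : V -> Prop) : Prop :=
  (forall N, G N -> card_lt N k) /\
  forall P, card_lt P k ->
    exists N, G N /\ subset P N /\ sigma1_elementary N /\ is_ordinal (cap N k).

Definition lt_closed (r N : V) : Prop :=
  forall x, subset x N -> card_lt x r -> x ∈ N.

(** * Sorted infinitary signatures and their structures *)

(* Symbols are tagged with 0, 1, 2 and carry their type: [d] is the sequence of
   argument sorts, indexed by the arity (an ordinal), and [s] the value sort. *)
Definition sort_sym (n : V) : V := opair empty n.
Definition fun_sym (n d s : V) : V :=
  opair (succ empty) (opair n (opair d s)).
Definition rel_sym (n d : V) : V :=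
  opair (succ (succ empty)) (opair n d).

Definition sorts (L : V) : V := sep L (fun s => exists n, s = sort_sym n).

Definition is_argument_type (L d : V) : Prop :=
  exists i, is_ordinal i /\ func d i (sorts L).

(* A signature is the set of its symbols. *)
Definition is_signature (L : V) : Prop :=
  forall x, x ∈ L ->
    (exists n, x = sort_sym n) \/
    (exists n d s, x = fun_sym n d s /\ is_argument_type L d /\ s ∈ sorts L) \/
    (exists n d, x = rel_sym n d /\ is_argument_type L d).

Definition has_arity (x i : V) : Prop :=
  (exists n d s, x = fun_sym n d s /\ i = dom d) \/
  (exists n d, x = rel_sym n d /\ i = dom d).

Definition bounds_arities (L r : V) : Prop :=
  forall x i, x ∈ L -> has_arity x i -> i ∈ r.

(* r = ar(L) *)
Definition is_ar (L r : V) : Prop :=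
  is_regular r /\ bounds_arities L r /\
  forall r', is_regular r' -> bounds_arities L r' -> subset r r'.

(* A structure is a pair (U, I) of a universe and a function I on the symbols.
   The sorts form a partition of U, so that a sorted map is a function on U. *)
Definition carrier (A : V) : V := the (fun U => exists I, A = opair U I).
Definition interp (A x : V) : V :=
  the (fun y => exists U I, A = opair U I /\ opair x y ∈ I).

Definition tuples (A d : V) : V :=
  sep (power (prod (dom d) (carrier A)))
      (fun t => func t (dom d) (carrier A) /\
                forall i, i ∈ dom d -> app t i ∈ interp A (app d i)).

Definition is_structure (L A : V) : Prop :=
  (exists U I Y, A = opair U I /\ func I L Y) /\
  (forall s, s ∈ sorts L -> subset (interp A s) (carrier A)) /\
  (forall a, a ∈ carrier A -> exists! s, s ∈ sorts L /\ a ∈ interp A s) /\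
  (forall n d s, fun_sym n d s ∈ L ->
     func (interp A (fun_sym n d s)) (tuples A d) (interp A s)) /\
  (forall n d, rel_sym n d ∈ L ->
     subset (interp A (rel_sym n d)) (tuples A d)).

Definition is_hom (L A B f : V) : Prop :=
  func f (carrier A) (carrier B) /\
  (forall s a, s ∈ sorts L -> a ∈ interp A s -> app f a ∈ interp B s) /\
  (forall n d s t, fun_sym n d s ∈ L -> t ∈ tuples A d ->
     app f (app (interp A (fun_sym n d s)) t)
     = app (interp B (fun_sym n d s)) (comp f t)) /\
  (forall n d t, rel_sym n d ∈ L -> t ∈ interp A (rel_sym n d) ->
     comp f t ∈ interp B (rel_sym n d)).

(* N ∩ A with the structure induced by A *)
Definition restrict_interp (A N x : V) : V :=
  sep (interp A x) (fun z =>
    (forall n, x = sort_sym n -> z ∈ N) /\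
    (forall n d s, x = fun_sym n d s ->
       forall t y, z = opair t y -> subset (ran t) N) /\
    (forall n d, x = rel_sym n d -> subset (ran z) N)).

Definition substructure (L A N : V) : V :=
  opair (cap (carrier A) N)
        (repl (fun x p => p = opair x (restrict_interp A N x)) L).

(** * Subcategories of Str L *)

(* [mor A B f]: the graph f is an arrow from A to B. *)
Record subcategory (L : V) : Type := Subcategory {
  obj : V -> Prop;
  mor : V -> V -> V -> Prop;
  obj_structure : forall A, obj A -> is_structure L A;
  mor_hom : forall A B f, mor A B f -> obj A /\ obj B /\ is_hom L A B f;
  mor_id : forall A, obj A -> mor A A (idmap (carrier A));
  mor_comp : forall A B C f g, mor A B f -> mor B C g -> mor A C (comp g f)
}.

Section Categories.
Variable L : V.
Implicit Types (K C : subcategory L) (N : V).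

Definition subcategory_of K C : Prop :=
  (forall A, obj K A -> obj C A) /\
  (forall A B f, mor K A B f -> mor C A B f).

Definition is_iso C (A B u : V) : Prop :=
  mor C A B u /\
  exists v, mor C B A v /\
    comp v u = idmap (carrier A) /\ comp u v = idmap (carrier B).

Definition is_structure_iso (A B u : V) : Prop :=
  is_hom L A B u /\
  exists v, is_hom L B A v /\
    comp v u = idmap (carrier A) /\ comp u v = idmap (carrier B).

(* Every isomorphism of Str L between two objects of C is an arrow of C; this
   holds if C is full, or if C is closed under isomorphic copies in Str L.  The
   condition excludes categories such as sets with inclusions as only arrows,
   where C-isomorphic means equal and a type (b, A ⊆ B) determines b, so that
   gS¹(A) is a proper class. *)
Definition contains_isos C : Prop :=
  forall A B u, obj C A -> obj C B -> is_structure_iso A B u -> mor C A B u.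

(* The square with i : B -> P and j : B' -> P is a pushout in C of the span
   f : A -> B, g : A -> B'. *)
Definition is_pushout C (A B B' f g P i j : V) : Prop :=
  mor C A B f /\ mor C A B' g /\ mor C B P i /\ mor C B' P j /\
  comp i f = comp j g /\
  forall D u v, mor C B D u -> mor C B' D v -> comp u f = comp v g ->
    exists! w, mor C P D w /\ comp w i = u /\ comp w j = v.

Definition has_pushouts C : Prop :=
  forall A B B' f g, mor C A B f -> mor C A B' g ->
    exists P i j, is_pushout C A B B' f g P i j.

Definition arrows_closed_under_iso_in K C : Prop :=
  forall A B A' B' f f' u v,
    mor C A B f -> mor C A' B' f' -> is_iso C A A' u -> is_iso C B B' v ->
    comp v f = comp f' u ->
    (mor K A B f <-> mor K A' B' f').

(** ** The Löwenheim-Skolem property *)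

Definition appropriate N : Prop :=
  subset L N /\ L ∈ N /\ sigma1_elementary N /\
  exists r, is_ar L r /\ lt_closed r N.

Definition mor_in K N (A B f : V) : Prop :=
  mor K A B f /\ f ∈ N /\ A ∈ N /\ B ∈ N.

(* Graph of the inclusion of N ∩ A in A *)
Definition incl N (A : V) : V := idmap (cap (carrier A) N).

Definition category_appropriate K N : Prop :=
  appropriate N /\
  forall A B f, mor_in K N A B f ->
    obj K (substructure L A N) /\ obj K (substructure L B N) /\
    mor K (substructure L A N) (substructure L B N) (restrict f N) /\
    mor K (substructure L A N) A (incl N A) /\
    mor K (substructure L B N) B (incl N B).

Definition LS_on K (G : V -> Prop) : Prop :=
  forall N, G N -> category_appropriate K N.

(* the <k-Uniformly Stationary LS Property *)
Definition lt_USLS K (k : V) : Prop :=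
  exists G, stationary k G /\ LS_on K G.

(* the l-Uniformly Stationary LS Property *)
Definition USLS K (l : V) : Prop :=
  is_infinite_cardinal l /\ exists l', is_succ_cardinal l l' /\ lt_USLS K l'.

(* For the pushout P(C,f,N), with legs i : A -> P and j : N ∩ B -> P, the map
   i and the map h : P -> B induced by f and N ∩ B ⊆ B both lie in K. *)
Definition pushout_maps_in K C N (A B f : V) : Prop :=
  exists P i j h,
    is_pushout C (substructure L A N) A (substructure L B N)
      (incl N A) (restrict f N) P i j /\
    mor C P B h /\ comp h i = f /\ comp h j = incl N B /\
    mor K A P i /\ mor K P B h.

Definition lt_USLS_factoring C K (k : V) : Prop :=
  has_pushouts C /\
  exists G, stationary k G /\ LS_on C G /\
    forall N, G N -> forall A B f, mor_in K N A B f ->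
      pushout_maps_in K C N A B f.

(** ** Galois types and stability *)

Record pointed_arrow K (A : V) : Type := PointedArrow {
  target : V;
  arrow : V;
  point : V;
  arrow_mor : mor K A target arrow;
  point_mem : point ∈ carrier target
}.

Definition atomic K (A : V) (p q : pointed_arrow K A) : Prop :=
  exists D g' f', mor K (target p) D g' /\ mor K (target q) D f' /\
    comp g' (arrow p) = comp f' (arrow q) /\
    app g' (point p) = app f' (point q).

Definition galois_equiv K (A : V) : relation (pointed_arrow K A) :=
  clos_refl_sym_trans (pointed_arrow K A) (@atomic K A).

(* gS¹(A), the collection of the equivalence classes *)
Definition gS1 K (A : V) (T : pointed_arrow K A -> Prop) : Prop :=
  exists p, T = @galois_equiv K A p.

Definition stable K (l : V) : Prop :=
  forall A, obj K A -> card_eq (carrier A) l ->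
    exists h : (pointed_arrow K A -> Prop) -> V,
      (forall T, @gS1 K A T -> h T ∈ l) /\
      (forall T T', @gS1 K A T -> @gS1 K A T' -> h T = h T' -> T = T').

End Categories.
End SetTheory.

(* Main.v *)
From Stdlib Require Import Relations ClassicalEpsilon FunctionalExtensionality
  PropExtensionality ProofIrrelevance.
Require Import Defs.

(** Fix a K-object A with |A| = λ.  A Galois type over A is given by an arrow
f : A -> B of K and a point b of B.  Choose a set N of size < κ in the
stationary class of hypothesis (iii) with A, B, f, b ∈ N.  The pushout P in C
of A ⊇ N ∩ A -> N ∩ B splits f as A -> P -> B, with both factors in K, and b
is the image of the point b of N ∩ B; so (b, f) has the same type as the image
of b in P ([galois_equiv_pushout]).  Hence the type depends only on the span
A ⊇ N ∩ A -> N ∩ B and on b, and only up to isomorphisms of N ∩ B over N ∩ A: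
isomorphic spans have C-isomorphic pushouts ([pushout_iso]), and by (iv) the
comparison isomorphism is an arrow of K ([iso_mor]).

It remains to count such spans.  Enumerate N by an ordinal i ∈ κ
([enumerated_of_card_lt]) and record two things along the enumeration: the
finitary relations on N that say how elements of N act as points of B, as pairs
of f, as tuples and as graphs of the operations of B; and the names of those
elements of N that lie in A or in a fixed set M of size < κ which contains the
symbols of L and the ordinals below ar(L).  This record is the [shape].
Although operations of B are infinitary, a record of finitary relations
suffices: N is < ar(L)-closed, so that every tuple of elements of N indexed by
an arity is itself an element of N ([closed_func]).  Two sets N with the same
shape therefore have the same trace on A, and their traces on the codomains are
isomorphic over it ([transfer_iso], [transfer_restrict]).

A shape consists of functions of several variables in i with values in sets of
size ≤ λ.  Since λ^{<κ} = λ, functions i -> λ are coded by elements of λ, and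
currying reduces several variables to one ([small_fun]); so there are at most
λ shapes ([small_shape]), hence at most λ types. *)

Set Implicit Arguments.
Unset Strict Implicit.
Unset Printing Implicit Defensive.

(** * Sets, pairs and functions *)

Section Sets.
Variable V : universe.
Implicit Types (a b c d f g h i k n r x y z A B N U I L P : V).

Lemma in_sep x (Q : V -> Prop) z : z ∈ sep x Q <-> z ∈ x /\ Q z.
Proof.
unfold sep; rewrite mem_repl.
- split; [intros (t & Ht & <- & Hq) | intros []; exists z]; auto.
- intros t y y' _ [<- _] [<- _]; reflexivity.
Qed.

Lemma the_eq (Q : V -> Prop) a : Q a -> (forall y, Q y -> y = a) -> the Q = a.
Proof.
intros Ha Hu; apply extensionality; intro z; unfold the.
rewrite mem_union; split.
- intros (y & Hz & Hy); apply mem_repl in Hy.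
  + destruct Hy as (_ & _ & Hy); rewrite <- (Hu y Hy); exact Hz.
  + intros _ y1 y2 _ H1 H2; rewrite (Hu _ H1), (Hu _ H2); reflexivity.
- intro Hz; exists a; split; [exact Hz|]; apply mem_repl.
  + intros _ y1 y2 _ H1 H2; rewrite (Hu _ H1), (Hu _ H2); reflexivity.
  + exists empty; split; [apply mem_upair; left|]; trivial.
Qed.

Lemma in_sing a z : z ∈ sing a <-> z = a.
Proof. unfold sing; rewrite mem_upair; tauto. Qed.

Lemma in_cup x y z : z ∈ cup x y <-> z ∈ x \/ z ∈ y.
Proof.
unfold cup; rewrite mem_union; split.
- intros (t & Ht & Hu); apply mem_upair in Hu as [-> | ->]; auto.
- intros [H | H]; [exists x | exists y]; rewrite mem_upair; auto.
Qed.

Lemma in_cap x y z : z ∈ cap x y <-> z ∈ x /\ z ∈ y.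
Proof. unfold cap; rewrite in_sep; reflexivity. Qed.

Lemma in_succ x z : z ∈ succ x <-> z ∈ x \/ z = x.
Proof. unfold succ; rewrite in_cup, in_sing; tauto. Qed.

Lemma mem_irrefl x : ~ x ∈ x.
Proof.
intro H; destruct (foundation (x := sing x)) as (y & Hy & Hn).
- exists x; apply in_sing; reflexivity.
- apply in_sing in Hy; subst y; apply Hn; exists x.
  split; [exact H | apply in_sing; reflexivity].
Qed.

Lemma empty_neq_succ x : empty <> succ x.
Proof.
intro H; apply (@mem_empty V x); rewrite H; apply in_succ; auto.
Qed.

Lemma succ_neq x : x <> succ x.
Proof.
intro H; apply (@mem_irrefl x); rewrite H at 2; apply in_succ; auto.
Qed.

Lemma upair_inj a b c d : upair a b = upair c d ->
  a = c /\ b = d \/ a = d /\ b = c.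
Proof.
intro H.
assert (H1 : a ∈ upair c d) by (rewrite <- H; apply mem_upair; auto).
assert (H2 : b ∈ upair c d) by (rewrite <- H; apply mem_upair; auto).
assert (H3 : c ∈ upair a b) by (rewrite H; apply mem_upair; auto).
assert (H4 : d ∈ upair a b) by (rewrite H; apply mem_upair; auto).
apply mem_upair in H1, H2, H3, H4; intuition congruence.
Qed.

Lemma opair_inj a b c d : opair a b = opair c d -> a = c /\ b = d.
Proof.
unfold opair, sing; intro H.
apply upair_inj in H as [[H1 H2] | [H1 H2]];
  apply upair_inj in H1; apply upair_inj in H2; intuition congruence.
Qed.

Lemma in_prod x y p : p ∈ prod x y <->
  exists a b, a ∈ x /\ b ∈ y /\ p = opair a b.
Proof.
unfold prod; rewrite in_sep; split; [tauto|].
intros (a & b & Ha & Hb & ->); split; [|eauto].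
apply mem_power; intros z Hz; apply mem_power; intros t Ht.
apply mem_upair in Hz as [-> | ->]; apply in_cup;
  [apply in_sing in Ht as -> | apply mem_upair in Ht as [-> | ->]]; auto.
Qed.

Lemma in_prod_opair x y a b : opair a b ∈ prod x y <-> a ∈ x /\ b ∈ y.
Proof.
rewrite in_prod; split; [|intros []; eauto].
intros (a' & b' & ? & ? & H); apply opair_inj in H as [-> ->]; auto.
Qed.

Lemma in_dom f a : a ∈ dom f <-> exists b, opair a b ∈ f.
Proof.
unfold dom; rewrite in_sep; split; [tauto|].
intros [b Hb]; split; [|eauto]; apply mem_union; exists (sing a).
split; [apply in_sing; reflexivity|]; apply mem_union; exists (opair a b).
split; [apply mem_upair|]; auto.
Qed.

Lemma in_ran f b : b ∈ ran f <-> exists a, opair a b ∈ f.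
Proof.
unfold ran; rewrite in_sep; split; [tauto|].
intros [a Ha]; split; [|eauto]; apply mem_union; exists (upair a b).
split; [apply mem_upair; auto|]; apply mem_union; exists (opair a b).
split; [apply mem_upair|]; auto.
Qed.

Definition is_rel f : Prop := forall p, p ∈ f -> exists a b, p = opair a b.

Lemma rel_ext f g : is_rel f -> is_rel g ->
  (forall a b, opair a b ∈ f <-> opair a b ∈ g) -> f = g.
Proof.
intros Hf Hg H; apply extensionality; intro p; split; intro Hp;
  [destruct (Hf p Hp) as (a & b & ->) | destruct (Hg p Hp) as (a & b & ->)];
  apply H; exact Hp.
Qed.

Lemma func_rel f x y : func f x y -> is_rel f.
Proof. intros [H _] p Hp; apply H, in_prod in Hp as (a & b & _ & _ & ->); eauto. Qed.

Lemma func_pair f x y a b : func f x y -> opair a b ∈ f -> a ∈ x /\ b ∈ y.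
Proof. intros [H _] Hp; apply in_prod_opair, H, Hp. Qed.

Lemma func_unique f x y a b b' :
  func f x y -> opair a b ∈ f -> opair a b' ∈ f -> b = b'.
Proof.
intros Hf H H'; destruct (func_pair Hf H) as [Ha _].
destruct Hf as [_ Hf]; destruct (Hf a Ha) as (t & _ & Ht).
rewrite <- (Ht b H); apply Ht, H'.
Qed.

Lemma func_app f x y a b : func f x y -> opair a b ∈ f -> app f a = b.
Proof.
intros Hf H; apply the_eq; [exact H|].
intros b' H'; exact (func_unique Hf H' H).
Qed.

Lemma app_pair f x y a : func f x y -> a ∈ x -> opair a (app f a) ∈ f.
Proof.
intros Hf Ha; destruct (proj2 Hf a Ha) as (b & Hb & _).
rewrite (func_app Hf Hb); exact Hb.
Qed.

Lemma app_in f x y a : func f x y -> a ∈ x -> app f a ∈ y.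
Proof. intros Hf Ha; exact (proj2 (func_pair Hf (app_pair Hf Ha))). Qed.

(** Inclusion between functions with the same domain is equality; so only one
inclusion has to be checked whenever two functions are compared. *)
Lemma func_sub_eq f g x y y' : func f x y -> func g x y' ->
  (forall a b, opair a b ∈ f -> opair a b ∈ g) -> f = g.
Proof.
intros Hf Hg H; apply rel_ext; [exact (func_rel Hf) | exact (func_rel Hg) |].
intros a b; split; [apply H|]; intro Hb.
destruct (func_pair Hg Hb) as [Ha _].
assert (H' := app_pair Hf Ha); rewrite (func_unique Hg Hb (H _ _ H')); exact H'.
Qed.

Lemma in_comp f g a c :
  opair a c ∈ comp g f <-> exists b, opair a b ∈ f /\ opair b c ∈ g.
Proof.
unfold comp; rewrite in_sep; split.
- intros (_ & a' & b & c' & H & Hf & Hg); apply opair_inj in H as [-> ->]; eauto.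
- intros (b & Hf & Hg); split; [|eauto 7].
  apply in_prod_opair; rewrite in_dom, in_ran; eauto.
Qed.

Lemma comp_rel f g : is_rel (comp g f).
Proof. intros p Hp; apply in_sep in Hp as (_ & a & b & c & -> & _); eauto. Qed.

Lemma comp_assoc f g h : comp h (comp g f) = comp (comp h g) f.
Proof.
apply rel_ext; try apply comp_rel; intros a b.
rewrite !in_comp; split.
- intros (t & H & H'); apply in_comp in H as (u & ? & ?).
  exists u; rewrite in_comp; eauto.
- intros (t & H & H'); apply in_comp in H' as (u & ? & ?).
  exists u; rewrite in_comp; eauto.
Qed.

Lemma comp_func f g x y z : func f x y -> func g y z -> func (comp g f) x z.
Proof.
intros Hf Hg; split.
- intros p Hp; destruct (comp_rel Hp) as (a & b & ->).
  apply in_comp in Hp as (c & H & H'); apply in_prod_opair.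
  split; [apply (func_pair Hf H) | apply (func_pair Hg H')].
- intros a Ha; assert (H := app_pair Hf Ha).
  assert (H' := app_pair Hg (app_in Hf Ha)).
  exists (app g (app f a)); split; [apply in_comp; eauto|].
  intros b Hb; apply in_comp in Hb as (c & H1 & H2).
  rewrite (func_app Hf H1), (func_app Hg H2); reflexivity.
Qed.

Lemma app_comp f g x y z a : func f x y -> func g y z -> a ∈ x ->
  app (comp g f) a = app g (app f a).
Proof.
intros Hf Hg Ha; apply (func_app (comp_func Hf Hg)), in_comp.
exists (app f a); split; [exact (app_pair Hf Ha)|].
exact (app_pair Hg (app_in Hf Ha)).
Qed.

Lemma in_idmap x a b : opair a b ∈ idmap x <-> a ∈ x /\ a = b.
Proof.
unfold idmap; rewrite in_sep, in_prod_opair; split.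
- intros ([Ha _] & c & H); apply opair_inj in H as [-> ->]; auto.
- intros [Ha <-]; eauto.
Qed.

Lemma idmap_func x : func (idmap x) x x.
Proof.
split; [intros p Hp; apply in_sep in Hp; tauto|].
intros a Ha; exists a; split; [apply in_idmap; auto|].
intros b Hb; apply in_idmap in Hb; tauto.
Qed.

Lemma app_idmap x a : a ∈ x -> app (idmap x) a = a.
Proof. intro Ha; apply (func_app (idmap_func x)), in_idmap; auto. Qed.

Lemma comp_idmap_l f x y : func f x y -> comp (idmap y) f = f.
Proof.
intro Hf; apply rel_ext; [apply comp_rel | exact (func_rel Hf) |]; intros a b.
rewrite in_comp; split.
- intros (c & H & H'); apply in_idmap in H' as [_ <-]; exact H.
- intro H; exists b; rewrite in_idmap; split; [|split]; trivial.
  apply (func_pair Hf H).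
Qed.

Lemma comp_idmap_r f x y : func f x y -> comp f (idmap x) = f.
Proof.
intro Hf; apply rel_ext; [apply comp_rel | exact (func_rel Hf) |]; intros a b.
rewrite in_comp; split.
- intros (c & H & H'); apply in_idmap in H as [_ ->]; exact H'.
- intro H; exists a; rewrite in_idmap; split; [split|]; trivial.
  apply (func_pair Hf H).
Qed.

Lemma in_restrict f x a b : opair a b ∈ restrict f x <-> opair a b ∈ f /\ a ∈ x.
Proof.
unfold restrict; rewrite in_sep; split.
- intros (H & a' & b' & E & Ha); apply opair_inj in E as [-> ->]; auto.
- intros []; eauto.
Qed.

(** The argument of F carries its membership proof, so that functions defined
only on the elements of x have a graph. *)
Definition graph x (F : {z | z ∈ x} -> V) : V :=
  repl (fun z p => exists H : z ∈ x, p = opair z (F (exist _ z H))) x.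

Lemma in_graph x (F : {z | z ∈ x} -> V) p :
  p ∈ graph F <-> exists s, p = opair (proj1_sig s) (F s).
Proof.
unfold graph; rewrite mem_repl.
- split; [intros (z & _ & H & ->); exists (exist _ z H); reflexivity|].
  intros (s & ->); exists (proj1_sig s); split; [apply proj2_sig|].
  exists (proj2_sig s); destruct s; reflexivity.
- intros z p1 p2 _ [H ->] [H' ->]; rewrite (proof_irrelevance _ H H'); reflexivity.
Qed.

Lemma sig_ext (T : Type) (Q : T -> Prop) (s t : {z | Q z}) :
  proj1_sig s = proj1_sig t -> s = t.
Proof. destruct s, t; apply subset_eq_compat. Qed.

Lemma in_graph_sig x (F : {z | z ∈ x} -> V) s b :
  opair (proj1_sig s) b ∈ graph F <-> b = F s.
Proof.
rewrite in_graph; split; [|intros ->; eauto].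
intros (t & H); apply opair_inj in H as [H ->].
rewrite (sig_ext H); reflexivity.
Qed.

Lemma graph_func x y (F : {z | z ∈ x} -> V) :
  (forall s, F s ∈ y) -> func (graph F) x y.
Proof.
intro HF; split.
- intros p Hp; apply in_graph in Hp as ([z Hz] & ->); apply in_prod_opair; auto.
- intros a Ha; exists (F (exist _ a Ha)).
  split; [apply (in_graph_sig _ (exist _ a Ha)); reflexivity|].
  intros b Hb; symmetry; apply (in_graph_sig _ (exist _ a Ha)), Hb.
Qed.

(** * Cardinality *)

(** By replacement, class functions between sets have graphs, so cardinal
inequalities can be handled with functions of the ambient logic. *)
Lemma card_leP x y : card_le x y <->
  exists F : V -> V, (forall a, a ∈ x -> F a ∈ y) /\
    forall a a', a ∈ x -> a' ∈ x -> F a = F a' -> a = a'.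
Proof.
split.
- intros (f & Hf & Hi); exists (app f); split; [intro; apply (app_in Hf)|].
  intros a a' Ha Ha' E; apply (Hi a a' (app f a)); [|rewrite E];
    apply (app_pair Hf); assumption.
- intros (F & HF & Hi).
  exists (graph (fun s : {z | z ∈ x} => F (proj1_sig s))); split.
  + apply graph_func; intros [z Hz]; auto.
  + intros a a' b H H'; apply in_graph in H as ([z Hz] & E).
    apply in_graph in H' as ([z' Hz'] & E').
    apply opair_inj in E as [-> ->]; apply opair_inj in E' as [-> E'].
    apply Hi; auto.
Qed.

Lemma card_le_sub x y : subset x y -> card_le x y.
Proof. intro H; apply card_leP; exists (fun z => z); auto. Qed.

Lemma card_le_trans x y z : card_le x y -> card_le y z -> card_le x z.
Proof.
rewrite !card_leP; intros (F & HF & Fi) (G & HG & Gi).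
exists (fun a => G (F a)); auto.
Qed.

(** Values outside x are allowed, so that the empty set and the stages of a
recursive choice need no default element. *)
Definition enumerated i x : Prop :=
  exists F : V -> V, forall z, z ∈ x -> exists j, j ∈ i /\ F j = z.

Lemma enumerated_card_le i x : enumerated i x -> card_le x i.
Proof.
intros [F HF].
set (G z := epsilon (inhabits z) (fun j => j ∈ i /\ F j = z)).
assert (HG : forall z, z ∈ x -> G z ∈ i /\ F (G z) = z)
  by (intros z Hz; apply epsilon_spec, HF, Hz).
apply card_leP; exists G; split; [apply HG|].
intros a a' Ha Ha' E.
rewrite <- (proj2 (HG a Ha)), <- (proj2 (HG a' Ha')), E; reflexivity.
Qed.

Lemma enumerated_card_lt k i x :
  is_cardinal k -> i ∈ k -> enumerated i x -> card_lt x k.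
Proof.
intros [[Ht _] Hk] Hi Hx; apply enumerated_card_le in Hx; split.
- exact (card_le_trans Hx (card_le_sub (Ht i Hi))).
- intro H; exact (Hk i Hi (card_le_trans H Hx)).
Qed.

(** Foundation is available for sets only; restricting membership to the
elements of a transitive set k keeps each descending chain inside k. *)
Lemma mem_ordinal_wf k :
  is_ordinal k -> well_founded (fun i j => i ∈ j /\ j ∈ k).
Proof.
intros [Ht _].
assert (H : forall j, j ∈ k -> Acc (fun i j => i ∈ j /\ j ∈ k) j).
{ intros j Hj; apply NNPP; intro Hn.
  destruct (foundation (x := sep k (fun z => ~ Acc (fun i j => i ∈ j /\ j ∈ k) z)))
    as (y & Hy & Hmin); [exists j; apply in_sep; auto|].
  apply in_sep in Hy as [Hy Hn']; apply Hn'; constructor; intros i [Hi _].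
  apply NNPP; intro Hn''; apply Hmin; exists i; split; [exact Hi|].
  apply in_sep; split; [exact (Ht y Hy i Hi) | exact Hn'']. }
intro j; constructor; intros i [Hi Hj]; exact (H i (Ht j Hj i Hi)).
Qed.

(** Choose recursively, for j ∈ k, an element F j of N that differs from all
F i with i ∈ j.  If a choice were always possible, F would inject k into N; so
at some j ∈ k the values F i with i ∈ j exhaust N. *)
Lemma enumerated_of_card_lt k N :
  is_ordinal k -> card_lt N k -> exists i, i ∈ k /\ enumerated i N.
Proof.
intros Hk [_ Hlt].
set (fresh := fun j (F : forall i, i ∈ j /\ j ∈ k -> V) x =>
  x ∈ N /\ forall i (H : i ∈ j /\ j ∈ k), F i H <> x).
set (step := fun j F => epsilon (inhabits (@empty V)) (@fresh j F)).
set (F := Fix (mem_ordinal_wf Hk) (fun _ => set_of V) step).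
assert (HF : forall j, F j = step j (fun i _ => F i)).
{ intro j; apply (Fix_eq (mem_ordinal_wf Hk) (fun _ => set_of V) step).
  intros x g g' E; f_equal; extensionality i; extensionality H; apply E. }
apply NNPP; intro Hn; apply Hlt.
assert (Hfresh : forall j, j ∈ k -> fresh j (fun i _ => F i) (F j)).
{ intros j Hj; rewrite HF; apply epsilon_spec, NNPP; intro Hno.
  apply Hn; exists j; split; [exact Hj|]; exists F; intros z Hz.
  apply NNPP; intro Hz'; apply Hno; exists z; split; [exact Hz|].
  intros i [Hi _] E; apply Hz'; eauto. }
apply card_leP; exists F; split; [intros j Hj; apply (Hfresh j Hj)|].
intros a a' Ha Ha' E; destruct (proj2 Hk a a' Ha Ha') as [H | [H | H]]; trivial.
- destruct (proj2 (Hfresh a' Ha') a (conj H Ha') E).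
- destruct (proj2 (Hfresh a Ha) a' (conj H Ha) (eq_sym E)).
Qed.

Lemma empty_in_omega : empty ∈ omega V.
Proof. apply in_sep; split; [apply mem_inf | intros x [H _]; exact H]. Qed.

Lemma succ_in_omega n : n ∈ omega V -> succ n ∈ omega V.
Proof.
intro H; apply in_sep in H as [H H']; apply in_sep; split.
- apply mem_inf; exact H.
- intros x Hx; apply Hx, H', Hx.
Qed.

Lemma enumerated_empty x : enumerated x empty.
Proof. exists (fun z => z); intros z Hz; destruct (mem_empty Hz). Qed.

(** The new element a takes the index n, which is not an element of itself, so
the values below n are unchanged. *)
Lemma enumerated_add n x y a : enumerated n x ->
  (forall z, z ∈ y -> z ∈ x \/ z = a) -> enumerated (succ n) y.
Proof.
intros [F HF] Hy.
exists (fun j => if excluded_middle_informative (j = n) then a else F j).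
intros z Hz; destruct (Hy z Hz) as [Hx | ->].
- destruct (HF z Hx) as (j & Hj & <-); exists j; rewrite in_succ; split; [auto|].
  destruct (excluded_middle_informative (j = n)) as [-> |]; [|reflexivity].
  destruct (mem_irrefl Hj).
- exists n; rewrite in_succ; split; [auto|].
  destruct (excluded_middle_informative (n = n)); tauto.
Qed.

Lemma enumerated_upair a b : enumerated (succ (succ empty)) (upair a b).
Proof.
apply (enumerated_add (x := sing a) (a := b)).
- apply (enumerated_add (x := empty) (a := a)); [apply enumerated_empty|].
  intros z Hz; apply in_sing in Hz; auto.
- intros z Hz; rewrite in_sing; apply mem_upair, Hz.
Qed.

Lemma card_lt_four k a b c d : is_infinite_cardinal k ->
  card_lt (cup (upair a b) (upair c d)) k.
Proof.
intros [Hk Hw].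
apply (enumerated_card_lt (i := succ (succ (succ (succ empty)))) Hk).
- apply Hw; repeat apply succ_in_omega; apply empty_in_omega.
- apply (enumerated_add (x := cup (upair a b) (sing c)) (a := d)).
  + apply (enumerated_add (x := upair a b) (a := c)); [apply enumerated_upair|].
    intros z Hz; apply in_cup in Hz as [Hz | Hz]; auto.
    apply in_sing in Hz; auto.
  + intros z Hz; rewrite in_cup, in_sing; apply in_cup in Hz as [Hz | Hz]; auto.
    apply mem_upair in Hz; tauto.
Qed.

(** * Closed sets contain their tuples *)

(** A < r-closed set is closed under pairs because 2 < r; by induction it
contains each ordinal i < r, as a subset of size < r; hence it contains each
function from such an i into it. *)
Section Closed.
Variables (r N : V) (Hr : is_regular r) (HN : lt_closed r N).

Lemma closed_enumerated i x : i ∈ r -> enumerated i x -> subset x N -> x ∈ N.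
Proof.
intros Hi Hx Hs; apply HN; [exact Hs|].
exact (enumerated_card_lt (proj1 (proj1 Hr)) Hi Hx).
Qed.

Lemma closed_upair a b : a ∈ N -> b ∈ N -> upair a b ∈ N.
Proof.
intros Ha Hb; apply (@closed_enumerated (succ (succ empty))).
- apply (proj2 (proj1 Hr)); repeat apply succ_in_omega; apply empty_in_omega.
- apply enumerated_upair.
- intros z Hz; apply mem_upair in Hz as [-> | ->]; assumption.
Qed.

Lemma closed_opair a b : a ∈ N -> b ∈ N -> opair a b ∈ N.
Proof. intros Ha Hb; repeat apply closed_upair; assumption. Qed.

Lemma closed_ordinals : subset r N.
Proof.
destruct Hr as [[[Ho Hc] _] _].
intro i; induction (mem_ordinal_wf Ho i) as [i _ IH]; intro Hi.
apply (@closed_enumerated i); trivial.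
- exists (fun z => z); eauto.
- intros j Hj; apply IH; [auto|]; exact (proj1 Ho i Hi j Hj).
Qed.

Lemma closed_func i t y : i ∈ r -> func t i y -> subset y N -> t ∈ N.
Proof.
intros Hi Ht Hy; apply (@closed_enumerated i); trivial.
- exists (fun j => opair j (app t j)); intros p Hp.
  destruct (func_rel Ht Hp) as (j & b & ->); exists j.
  rewrite (func_app Ht Hp); split; [apply (func_pair Ht Hp) | reflexivity].
- intros p Hp; destruct (func_rel Ht Hp) as (j & b & ->).
  destruct (func_pair Ht Hp) as [Hj Hb]; apply closed_opair; [|auto].
  apply closed_ordinals, (proj1 (proj1 (proj1 (proj1 Hr))) i Hi j Hj).
Qed.

End Closed.

Lemma is_ar_unique L r r' : is_ar L r -> is_ar L r' -> r = r'.
Proof.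
intros (H1 & H2 & H3) (H1' & H2' & H3'); apply extensionality; intro z.
split; [apply H3 | apply H3']; assumption.
Qed.

(** * Types of size at most λ *)

(** The size of a type of the ambient logic is measured by the elements of l.
Types of functions and dependent pairs then replace the corresponding sets. *)
Definition small l (T : Type) : Prop :=
  exists F : T -> V, (forall t, F t ∈ l) /\ forall t t', F t = F t' -> t = t'.

Lemma small_inj l (T U : Type) (F : T -> U) :
  (forall t t', F t = F t' -> t = t') -> small l U -> small l T.
Proof. intros HF (G & HG & Gi); exists (fun t => G (F t)); auto. Qed.

Lemma small_card_le x l : card_le x l -> small l {z | z ∈ x}.
Proof.
rewrite card_leP; intros (F & HF & Fi); exists (fun s => F (proj1_sig s)); split.
- intros [z Hz]; auto.
- intros [z Hz] [z' Hz'] E; apply sig_ext, Fi; auto.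
Qed.

Section Small.
Variables k l : V.
Hypothesis Hk : is_infinite_cardinal k.
Hypothesis Hl : is_infinite_cardinal l.
Hypothesis Hpow : card_le (lt_sequences l k) l.

Lemma graph_lt_sequences i (F : {z | z ∈ i} -> V) :
  i ∈ k -> (forall s, F s ∈ l) -> graph F ∈ lt_sequences l k.
Proof.
intros Hi HF; apply in_sep; split; [|exists i; split; [|apply graph_func]; auto].
apply mem_power; intros p Hp; apply in_graph in Hp as ([z Hz] & ->).
apply in_prod_opair; split; [exact (proj1 (proj1 (proj1 Hk)) i Hi z Hz) | auto].
Qed.

(** A function from i ∈ k to l is an element of l^{<k}, and hence coded in l.
Iterating this handles curried functions of several variables without any
comparison of i × i with i. *)
Lemma small_fun i (T : Type) : i ∈ k -> small l T -> small l ({z | z ∈ i} -> T).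
Proof.
intros Hi (F & HF & Fi); destruct (small_card_le Hpow) as (c & Hc & ci).
exists (fun g : {z | z ∈ i} -> T => c (exist (fun z => z ∈ lt_sequences l k) _
  (graph_lt_sequences (F := fun s => F (g s)) Hi (fun s => HF (g s))))).
split; [auto|]; intros g g' E; apply ci, (f_equal (@proj1_sig _ _)) in E.
simpl in E; extensionality s; apply Fi.
apply (in_graph_sig (fun s => F (g' s))); rewrite <- E.
apply in_graph_sig; reflexivity.
Qed.

Lemma zero_in : empty ∈ l.
Proof. apply (proj2 Hl), empty_in_omega. Qed.

Lemma small_prop : small l Prop.
Proof.
exists (fun Q => if excluded_middle_informative Q then succ empty else empty); split.
- intro Q; destruct (excluded_middle_informative Q); [|apply zero_in].
  apply (proj2 Hl), succ_in_omega, empty_in_omega.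
- intros Q Q' E; apply propositional_extensionality.
  destruct (excluded_middle_informative Q), (excluded_middle_informative Q');
    try tauto; [symmetry in E|]; destruct (empty_neq_succ E).
Qed.

(** Pairs are coded as functions on the ordinal 2 ∈ k. *)
Lemma small_prod (T U : Type) : small l T -> small l U -> small l (T * U).
Proof.
intros (F & HF & Fi) (G & HG & Gi).
assert (H2 : succ (succ empty) ∈ k)
  by (apply (proj2 Hk); repeat apply succ_in_omega; apply empty_in_omega).
assert (H0 : empty ∈ succ (succ (@empty V))) by (rewrite !in_succ; auto).
assert (H1 : succ empty ∈ succ (succ (@empty V))) by (rewrite !in_succ; auto).
refine (small_inj (F := fun p (s : {z | z ∈ succ (succ empty)}) =>
   if excluded_middle_informative (proj1_sig s = empty)
   then exist (fun z => z ∈ l) (F (fst p)) (HF _)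
   else exist (fun z => z ∈ l) (G (snd p)) (HG _)) _ (small_fun H2 _)).
- intros [t u] [t' u'] E; f_equal.
  + apply equal_f with (x := exist (fun z => z ∈ _) _ H0) in E.
    apply (f_equal (@proj1_sig _ _)) in E; simpl in E.
    destruct (excluded_middle_informative (@empty V = empty)); [auto | tauto].
  + apply equal_f with (x := exist (fun z => z ∈ _) _ H1) in E.
    apply (f_equal (@proj1_sig _ _)) in E; simpl in E.
    destruct (excluded_middle_informative (succ (@empty V) = empty)) as [e|]; auto.
    symmetry in e; destruct (empty_neq_succ e).
- apply small_card_le, card_le_sub; intro; trivial.
Qed.

Lemma small_option (T : Type) : small l T -> small l (option T).
Proof.
intros (F & HF & Fi).
refine (small_inj (F := fun o => match o with
  | Some t => (True, exist (fun z => z ∈ l) (F t) (HF t))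
  | None => (False, exist (fun z => z ∈ l) empty zero_in) end) _
  (small_prod small_prop (small_card_le (card_le_sub (fun z Hz => Hz))))).
intros [t|] [t'|] E; trivial.
- f_equal; apply Fi; exact (f_equal (fun p => proj1_sig (snd p)) E).
- destruct (eq_ind True (fun Q => Q) Logic.I _ (f_equal fst E)).
- destruct (eq_ind True (fun Q => Q) Logic.I _ (eq_sym (f_equal fst E))).
Qed.

Lemma small_sigT (T : Type) (D : T -> Type) :
  small l T -> (forall t, small l (D t)) -> small l {t : T & D t}.
Proof.
intros (F & HF & Fi) HD.
destruct (small_prod (small_card_le (card_le_sub (fun z (Hz : z ∈ l) => Hz)))
  (small_card_le (card_le_sub (fun z (Hz : z ∈ l) => Hz)))) as (c & Hc & ci).
set (G t := proj1_sig (constructive_indefinite_description _ (HD t))).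
assert (HG : forall t, (forall u, G t u ∈ l) /\ forall u u', G t u = G t u' -> u = u')
  by (intro t; exact (proj2_sig (constructive_indefinite_description _ (HD t)))).
set (inl := fun z => exist (fun z => z ∈ l) z).
exists (fun p : {t : T & D t} => c (inl _ (HF (projT1 p)),
                        inl _ (proj1 (HG (projT1 p)) (projT2 p)))).
split; [auto|]; intros [t u] [t' u'] E; apply ci in E; simpl in E.
assert (E1 := f_equal (fun p => proj1_sig (fst p)) E); simpl in E1.
assert (E2 := f_equal (fun p => proj1_sig (snd p)) E); simpl in E2.
apply Fi in E1; subst t'; apply HG in E2; subst u'; reflexivity.
Qed.

(** Distinct ordinals i ∈ k give distinct constant sequences of length i. *)
Lemma card_le_base : card_le k l.
Proof.
refine (card_le_trans _ Hpow); apply card_leP.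
exists (fun i => graph (fun _ : {z | z ∈ i} => @empty V)); split.
- intros i Hi; apply graph_lt_sequences; [exact Hi|]; intros _; apply zero_in.
- assert (H : forall i j, graph (fun _ : {z | z ∈ i} => @empty V)
     = graph (fun _ : {z | z ∈ j} => @empty V) -> subset i j).
  { intros i j E z Hz.
    assert (Hp : opair z empty ∈ graph (fun _ : {z | z ∈ i} => @empty V))
      by (apply in_graph; exists (exist _ z Hz); reflexivity).
    rewrite E in Hp; apply in_graph in Hp as ([z' Hz'] & Hp).
    apply opair_inj in Hp as [-> _]; exact Hz'. }
  intros i j _ _ E; apply extensionality; intro z.
  split; apply H; [|symmetry]; exact E.
Qed.

End Small.
End Sets.

(** * Substructures induced on a set *)

Section Structures.
Variables (V : universe) (L : V).
Implicit Types (a b c d f g h i k n r s t u w x y z A B N U I P : V).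

Lemma carrier_opair U I : carrier (opair U I) = U.
Proof.
apply the_eq; [eauto|]; intros U' (I' & H); apply opair_inj in H as [-> _]; auto.
Qed.

Lemma carrier_substructure B N : carrier (substructure L B N) = cap (carrier B) N.
Proof. apply carrier_opair. Qed.

Lemma interp_substructure B N x :
  x ∈ L -> interp (substructure L B N) x = restrict_interp B N x.
Proof.
intro Hx; unfold substructure.
set (I := repl _ L).
assert (HI : forall p, p ∈ I <-> exists x, x ∈ L /\ p = opair x (restrict_interp B N x))
  by (intro p; apply mem_repl; intros; congruence).
apply the_eq.
- exists (cap (carrier B) N), I; split; [reflexivity|]; apply HI; eauto.
- intros y (U & I' & H & Hy); apply opair_inj in H as [_ <-].
  apply HI in Hy as (x' & _ & H); apply opair_inj in H as [-> H]; exact H.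
Qed.

Lemma sort_fun_neq n n' d s : sort_sym n <> fun_sym n' d s.
Proof. intro H; apply opair_inj in H as [H _]; destruct (empty_neq_succ H). Qed.

Lemma sort_rel_neq n n' d : sort_sym n <> rel_sym n' d.
Proof. intro H; apply opair_inj in H as [H _]; destruct (empty_neq_succ H). Qed.

Lemma fun_rel_neq n d s n' d' : fun_sym n d s <> rel_sym n' d'.
Proof. intro H; apply opair_inj in H as [H _]; destruct (succ_neq H). Qed.

Lemma value_sort n d s : is_signature L -> fun_sym n d s ∈ L -> s ∈ sorts L.
Proof.
intros HL H.
destruct (HL _ H) as [(n' & E) | [(n' & d' & s' & E & _ & Hs) | (n' & d' & E & _)]].
- symmetry in E; destruct (sort_fun_neq E).
- apply opair_inj in E as [_ E]; apply opair_inj in E as [_ E].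
  apply opair_inj in E as [_ ->]; exact Hs.
- destruct (fun_rel_neq E).
Qed.

Lemma in_restrict_interp_sort B N n z :
  z ∈ restrict_interp B N (sort_sym n) <-> z ∈ interp B (sort_sym n) /\ z ∈ N.
Proof.
unfold restrict_interp; rewrite in_sep; split.
- intros (H & H1 & _); eauto.
- intros [H H1]; split; [exact H|]; split; [auto|]; split.
  + intros n' d s E; destruct (sort_fun_neq E).
  + intros n' d E; destruct (sort_rel_neq E).
Qed.

Lemma in_restrict_interp_fun B N n d s t y :
  opair t y ∈ restrict_interp B N (fun_sym n d s) <->
  opair t y ∈ interp B (fun_sym n d s) /\ subset (ran t) N.
Proof.
unfold restrict_interp; rewrite in_sep; split.
- intros (H & _ & H1 & _); eauto.
- intros [H H1]; split; [exact H|]; split; [|split].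
  + intros n' E; symmetry in E; destruct (sort_fun_neq E).
  + intros n' d' s' _ t' y' E; apply opair_inj in E as [<- _]; exact H1.
  + intros n' d' E; destruct (fun_rel_neq E).
Qed.

Lemma in_restrict_interp_rel B N n d t :
  t ∈ restrict_interp B N (rel_sym n d) <->
  t ∈ interp B (rel_sym n d) /\ subset (ran t) N.
Proof.
unfold restrict_interp; rewrite in_sep; split.
- intros (H & _ & _ & H1); eauto.
- intros [H H1]; split; [exact H|]; split; [|split].
  + intros n' E; symmetry in E; destruct (sort_rel_neq E).
  + intros n' d' s' E; symmetry in E; destruct (fun_rel_neq E).
  + auto.
Qed.

Lemma tuples_func A d t : t ∈ tuples A d -> func t (dom d) (carrier A).
Proof. intro H; apply in_sep in H; tauto. Qed.

(** * Comparing the traces of two closed sets *)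

(** Relations between three elements x, y, z of a set N that determine the trace
of f : A -> B and b ∈ B on N.  [Entry] describes an element of N as a tuple, and
[Graph], [Interp] describe the operations and relations of B, the symbol and
the tuple being elements of N themselves. *)
Inductive atom := Same | InCarrier | Maps | IsPoint | Entry | Interp | Graph.

Definition holds B f b (q : atom) x y z : Prop :=
  match q with
  | Same => x = y
  | InCarrier => x ∈ carrier B
  | Maps => opair x y ∈ f
  | IsPoint => x = b
  | Entry => opair y z ∈ x
  | Interp => y ∈ interp B x
  | Graph => opair y z ∈ interp B x
  end.

(** A closed set [elems] enumerated by S, together with an arrow out of A and a
point of its codomain.  That the trace of the codomain is a structure and that
the arrow restricts to the traces is what appropriateness of [elems] gives. *)
Record hull (S : Type) r A : Type := Hull {
  elems : V;
  cod : V;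
  arr : V;
  pt : V;
  enum : S -> V;
  enum_in : forall s : S, enum s ∈ elems;
  enum_onto : forall z, z ∈ elems -> exists s : S, enum s = z;
  elems_closed : lt_closed r elems;
  elems_symbols : subset L elems;
  cod_structure : is_structure L cod;
  trace_structure : is_structure L (substructure L cod elems);
  arr_func : func arr (carrier A) (carrier cod);
  trace_func : func (restrict arr elems)
                 (cap (carrier A) elems) (cap (carrier cod) elems);
  pt_cod : pt ∈ carrier cod;
  pt_elems : pt ∈ elems
}.

Arguments elems_closed {S r A} h.
Arguments elems_symbols {S r A} h.
Arguments cod_structure {S r A} h.
Arguments trace_structure {S r A} h.
Arguments arr_func {S r A} h.
Arguments trace_func {S r A} h.
Arguments pt_cod {S r A} h.
Arguments pt_elems {S r A} h.

Section Transfer.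
Variables (S : Type) (r A M : V).
Hypothesis HL : is_signature L.
Hypothesis Hr : is_regular r.
Hypothesis Har : bounds_arities L r.
Hypothesis HLM : subset L M.
Hypothesis HrM : subset r M.
Implicit Types G H : hull S r A.

Definition trace G : V := substructure L (cod G) (elems G).

(** The enumerations satisfy the same relations and give the same indices to the
elements of A and of M.  As M contains the symbols and the ordinals below ar(L),
these are fixed by the comparison, which is needed to compare tuples. *)
Definition agree G H : Prop :=
  (forall q (s u v : S),
     holds (cod G) (arr G) (pt G) q (enum G s) (enum G u) (enum G v) <->
     holds (cod H) (arr H) (pt H) q (enum H s) (enum H u) (enum H v)) /\
  (forall (s : S) x, x ∈ carrier A \/ x ∈ M -> enum G s = x <-> enum H s = x).

Lemma agree_sym G H : agree G H -> agree H G.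
Proof.
intros [H1 H2]; split.
- intros q s u v; symmetry; apply H1.
- intros s x Hx; symmetry; apply H2, Hx.
Qed.

(** The map [enum G s] ↦ [enum H s] between traces; it is single-valued because
agreeing enumerations repeat the same indices. *)
Definition transfer G H : V :=
  sep (prod (carrier (trace G)) (carrier (trace H)))
      (fun p => exists s : S, p = opair (enum G s) (enum H s)).

Lemma in_carrier_trace G z :
  z ∈ carrier (trace G) <-> z ∈ carrier (cod G) /\ z ∈ elems G.
Proof. unfold trace; rewrite carrier_substructure; apply in_cap. Qed.

Lemma in_transfer G H : agree G H -> forall x y, opair x y ∈ transfer G H <->
  exists s : S, x = enum G s /\ y = enum H s /\ x ∈ carrier (cod G).
Proof.
intros [HGH _] x y; unfold transfer; rewrite in_sep, in_prod_opair; split.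
- intros ([Hx _] & s & E); apply opair_inj in E as [-> ->].
  apply in_carrier_trace in Hx as [Hx _]; eauto.
- intros (s & -> & -> & Hx); split; [|eauto].
  split; apply in_carrier_trace; split; try apply enum_in; [exact Hx|].
  apply (HGH InCarrier s s s), Hx.
Qed.

Lemma transfer_func G H : agree G H ->
  func (transfer G H) (carrier (trace G)) (carrier (trace H)).
Proof.
intro HGH; split; [intros p Hp; apply in_sep in Hp; tauto|].
intros a Ha; apply in_carrier_trace in Ha as [Ha Ha'].
destruct (enum_onto Ha') as [s <-]; exists (enum H s); split.
- apply in_transfer; eauto.
- intros b Hb; apply in_transfer in Hb as (u & E & -> & _); trivial.
  apply (proj1 HGH Same s u s), E.
Qed.

Lemma agree_name G H : agree G H -> forall x, x ∈ elems G ->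
  x ∈ carrier A \/ x ∈ M -> exists s : S, enum G s = x /\ enum H s = x.
Proof.
intros [_ HGH] x Hx Hx'; destruct (enum_onto Hx) as [s Hs].
exists s; split; [exact Hs|]; apply (HGH s x Hx'), Hs.
Qed.

(** The index of a tuple in G is, in H, the index of its image: by the relation
[Entry], each entry of the first is sent to an entry of the second at the same
place, because the places are ordinals below r and have names. *)
Lemma comp_transfer_tuple G H : agree G H -> forall (u : S) i y, i ∈ r ->
  func (enum G u) i (carrier (trace G)) -> func (enum H u) i y ->
  comp (transfer G H) (enum G u) = enum H u.
Proof.
intros HGH u i y Hi Hu Hu'.
apply (func_sub_eq (comp_func Hu (transfer_func HGH)) Hu').
intros a b Hab; apply in_comp in Hab as (c & Hc & Hb).
apply in_transfer in Hb as (v & -> & -> & _); trivial.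
assert (Ha : a ∈ r)
  by (apply (proj1 (proj1 (proj1 (proj1 Hr))) i Hi), (func_pair Hu Hc)).
destruct (agree_name HGH (closed_ordinals Hr (elems_closed G) Ha)) as (s & Es & <-);
  [auto|].
apply (proj1 HGH Entry u s v); simpl; rewrite Es; exact Hc.
Qed.

Lemma ran_sub_trace G i t : func t i (carrier (trace G)) -> subset (ran t) (elems G).
Proof.
intros Ht b Hb; apply in_ran in Hb as [a Ha].
apply (in_carrier_trace G b), (func_pair Ht Ha).
Qed.

Lemma trace_tuple G i t : i ∈ r -> func t i (carrier (trace G)) ->
  exists u : S, enum G u = t.
Proof.
intros Hi Ht; apply enum_onto, (closed_func Hr (elems_closed G) Hi Ht).
intros z Hz; apply in_carrier_trace in Hz; tauto.
Qed.

(** Given an operation and a tuple t of the trace, both the symbol and t are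
elements of G and so have indices, and so does the value, since the trace is a
structure.  The relation [Graph] moves the equation to H, where the tuple with
the index of t is the image of t by [comp_transfer_tuple].  Relations and sorts
are treated in the same way with [Interp]. *)
Lemma transfer_hom G H : agree G H -> is_hom L (trace G) (trace H) (transfer G H).
Proof.
intro HGH; assert (Hw := transfer_func HGH).
assert (HI : forall (K : hull S r A) x, x ∈ L ->
  interp (trace K) x = restrict_interp (cod K) (elems K) x)
  by (intros; apply interp_substructure; assumption).
split; [exact Hw|]; split; [|split].
- intros s a Hs Ha; apply in_sep in Hs as [Hs [n ->]].
  rewrite HI in * by assumption.
  apply in_restrict_interp_sort in Ha as [Ha Ha'].
  destruct (enum_onto Ha') as [u <-].
  destruct (agree_name HGH (elems_symbols G _ Hs)) as (v & Ev & Ev'); [auto|].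
  assert (Hu : opair (enum G u) (enum H u) ∈ transfer G H).
  { apply in_transfer; trivial; exists u; split; [|split]; trivial.
    apply (proj1 (proj2 (cod_structure G)) (sort_sym n)); [|exact Ha].
    apply in_sep; eauto. }
  rewrite (func_app Hw Hu); apply in_restrict_interp_sort.
  split; [|apply enum_in].
  rewrite <- Ev'; apply (proj1 HGH Interp v u u); simpl; rewrite Ev; exact Ha.
- intros n d s t HF Ht.
  assert (Hd : dom d ∈ r) by (apply (Har HF); left; eauto).
  destruct (trace_structure G) as (_ & _ & _ & HfG & _).
  destruct (trace_structure H) as (_ & Hsorts & _ & HfH & _).
  specialize (HfG n d s HF); specialize (HfH n d s HF).
  fold (trace G) in HfG; fold (trace H) in HfH.
  assert (Hty := app_pair HfG Ht); set (y := app _ t) in *.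
  assert (Htf := tuples_func Ht).
  destruct (trace_tuple Hd Htf) as [u <-].
  destruct (agree_name HGH (elems_symbols G _ HF)) as (v & Ev & Ev'); [auto|].
  rewrite HI in Hty by assumption; apply in_restrict_interp_fun in Hty as [Hty _].
  assert (Hy : y ∈ carrier (trace G)).
  { apply (app_in HfG) in Ht; fold y in Ht; revert Ht.
    apply (proj1 (proj2 (trace_structure G)) s), (value_sort HL HF). }
  apply in_carrier_trace in Hy as [Hy Hy']; destruct (enum_onto Hy') as [m Em].
  rewrite <- Em in *.
  assert (Hm : opair (enum G m) (enum H m) ∈ transfer G H)
    by (apply in_transfer; eauto).
  rewrite (func_app Hw Hm); symmetry; apply (func_app HfH).
  assert (Hty' : opair (enum H u) (enum H m) ∈ interp (cod H) (fun_sym n d s)).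
  { rewrite <- Ev'; apply (proj1 HGH Graph v u m); simpl; rewrite Ev; exact Hty. }
  assert (Hu : comp (transfer G H) (enum G u) = enum H u).
  { destruct (cod_structure H) as (_ & _ & _ & Hf & _).
    destruct (func_pair (Hf n d s HF) Hty') as [Hu _].
    exact (comp_transfer_tuple HGH Hd Htf (tuples_func Hu)). }
  rewrite HI by assumption; apply in_restrict_interp_fun; rewrite Hu.
  split; [exact Hty'|]; rewrite <- Hu.
  exact (ran_sub_trace (comp_func Htf Hw)).
- intros n d t HR Ht.
  assert (Hd : dom d ∈ r) by (apply (Har HR); right; eauto).
  assert (Htf : func t (dom d) (carrier (trace G))).
  { destruct (trace_structure G) as (_ & _ & _ & _ & HrG).
    exact (tuples_func (HrG n d HR t Ht)). }
  destruct (trace_tuple Hd Htf) as [u <-].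
  destruct (agree_name HGH (elems_symbols G _ HR)) as (v & Ev & Ev'); [auto|].
  rewrite HI in * by assumption; apply in_restrict_interp_rel in Ht as [Ht _].
  assert (Ht' : enum H u ∈ interp (cod H) (rel_sym n d)).
  { rewrite <- Ev'; apply (proj1 HGH Interp v u u); simpl; rewrite Ev; exact Ht. }
  assert (Hu : comp (transfer G H) (enum G u) = enum H u).
  { destruct (cod_structure H) as (_ & _ & _ & _ & HrH).
    exact (comp_transfer_tuple HGH Hd Htf (tuples_func (HrH n d HR _ Ht'))). }
  apply in_restrict_interp_rel; rewrite Hu; split; [exact Ht'|]; rewrite <- Hu.
  exact (ran_sub_trace (comp_func Htf Hw)).
Qed.

Lemma comp_transfer G H : agree G H ->
  comp (transfer H G) (transfer G H) = idmap (carrier (trace G)).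
Proof.
intro HGH; assert (HHG := agree_sym HGH).
apply (func_sub_eq (comp_func (transfer_func HGH) (transfer_func HHG))
         (idmap_func _)).
intros a c Hac; apply in_comp in Hac as (b & Hb & Hc); apply in_idmap.
split; [exact (proj1 (func_pair (transfer_func HGH) Hb))|].
apply in_transfer in Hb as (s & -> & -> & _); trivial.
apply in_transfer in Hc as (u & E & -> & _); trivial.
apply (proj1 HHG Same s u s), E.
Qed.

Lemma transfer_iso G H : agree G H ->
  is_structure_iso L (trace G) (trace H) (transfer G H).
Proof.
intro HGH; split; [exact (transfer_hom HGH)|].
exists (transfer H G); split; [exact (transfer_hom (agree_sym HGH))|].
split; [exact (comp_transfer HGH) | exact (comp_transfer (agree_sym HGH))].
Qed.

Lemma agree_domain G H : agree G H ->
  cap (carrier A) (elems G) = cap (carrier A) (elems H).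
Proof.
assert (Hsub : forall G H, agree G H ->
  subset (cap (carrier A) (elems G)) (cap (carrier A) (elems H))).
{ intros G1 G2 H12 a Ha; apply in_cap in Ha as [Ha Ha']; apply in_cap.
  split; [exact Ha|].
  destruct (agree_name H12 Ha') as (s & _ & <-); [auto | apply enum_in]. }
intro HGH; apply extensionality; intro z.
split; apply Hsub; [|apply agree_sym]; exact HGH.
Qed.

Lemma transfer_restrict G H : agree G H ->
  comp (transfer G H) (restrict (arr G) (elems G)) = restrict (arr H) (elems H).
Proof.
intro HGH; assert (Hw := transfer_func HGH).
assert (HfG := trace_func G); assert (HfH := trace_func H).
rewrite <- (agree_domain HGH) in HfH.
unfold trace in Hw; rewrite !carrier_substructure in Hw.
apply (func_sub_eq (comp_func HfG Hw) HfH); intros a c Hac.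
apply in_comp in Hac as (b & Hab & Hb); apply in_restrict in Hab as [Hab Ha].
apply in_transfer in Hb as (u & -> & -> & _); trivial.
destruct (agree_name HGH Ha) as (s & Es & Es').
- left; apply (func_pair (arr_func G) Hab).
- apply in_restrict; split; [|rewrite <- Es'; apply enum_in].
  rewrite <- Es'; apply (proj1 HGH Maps s u u); simpl; rewrite Es; exact Hab.
Qed.

Lemma app_transfer_pt G H : agree G H -> app (transfer G H) (pt G) = pt H.
Proof.
intro HGH; apply (func_app (transfer_func HGH)), in_transfer; trivial.
destruct (enum_onto (pt_elems G)) as [s Hs].
exists s; split; [|split]; [auto | | apply pt_cod].
symmetry; apply (proj1 HGH IsPoint s s s), Hs.
Qed.
End Transfer.

(** * Pushouts *)

Section Pushouts.
Variable C : subcategory L.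

Lemma mor_func A B f : mor C A B f -> func f (carrier A) (carrier B).
Proof. intro H; apply (mor_hom H). Qed.

Lemma pushout_endo A B B' f g P i j w : is_pushout C A B B' f g P i j ->
  mor C P P w -> comp w i = i -> comp w j = j -> w = idmap (carrier P).
Proof.
intros (_ & _ & Hi & Hj & Hc & Hu) Hw Ei Ej.
destruct (Hu P i j Hi Hj Hc) as (w' & _ & Hw').
transitivity w'; [symmetry|]; apply Hw'; auto.
split; [apply mor_id, (mor_hom Hi)|].
split; [exact (comp_idmap_l (mor_func Hi)) | exact (comp_idmap_l (mor_func Hj))].
Qed.

Lemma pushout_iso A A0 A0' B B' inc f f' P P' i i' j j' u v :
  is_pushout C A0 A B inc f P i j -> is_pushout C A0' A B' inc f' P' i' j' ->
  mor C B B' u -> mor C B' B v -> comp v u = idmap (carrier B) ->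
  comp u v = idmap (carrier B') -> comp u f = f' ->
  exists w, is_iso C P P' w /\ comp w i = i' /\ comp w j = comp j' u.
Proof.
intros HP HP' Hu Hv Hvu Huv Ef.
pose proof HP as (Hinc & Hf & Hi & Hj & Hc & HU).
pose proof HP' as (Hinc' & Hf' & Hi' & Hj' & Hc' & HU').
assert (Ef' : comp v f' = f)
  by (rewrite <- Ef, comp_assoc, Hvu; apply (comp_idmap_l (mor_func Hf))).
destruct (HU P' i' (comp j' u) Hi' (mor_comp Hu Hj')) as (w & (Hw & Ewi & Ewj) & _).
{ rewrite <- comp_assoc, Ef; exact Hc'. }
destruct (HU' P i (comp j v) Hi (mor_comp Hv Hj)) as (w' & (Hw' & Ewi' & Ewj') & _).
{ rewrite <- comp_assoc, Ef'; exact Hc. }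
exists w; split; [|auto]; split; [exact Hw|].
exists w'; split; [exact Hw'|]; split.
- apply (pushout_endo HP); [exact (mor_comp Hw Hw') | |]; rewrite <- comp_assoc.
  + rewrite Ewi; exact Ewi'.
  + rewrite Ewj, comp_assoc, Ewj', <- comp_assoc, Hvu.
    apply (comp_idmap_r (mor_func Hj)).
- apply (pushout_endo HP'); [exact (mor_comp Hw' Hw) | |]; rewrite <- comp_assoc.
  + rewrite Ewi'; exact Ewi.
  + rewrite Ewj', comp_assoc, Ewj, <- comp_assoc, Huv.
    apply (comp_idmap_r (mor_func Hj')).
Qed.
End Pushouts.
End Structures.

(** * Galois types *)

Section GaloisTypes.
Variables (V : universe) (L : V) (C K : subcategory L).
Implicit Types (a b c f i j k l n r x y z A B M N P : V).
Hypothesis HKC : subcategory_of K C.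
Hypothesis HC : contains_isos C.
Hypothesis Hiv : arrows_closed_under_iso_in K C.

(** Apply closure under isomorphisms to the square with top and left sides w and
identities on the other two: its bottom arrow is in K. *)
Lemma iso_mor P P' w : obj K P' -> is_iso C P P' w -> mor K P P' w.
Proof.
intros HP' Hw; assert (Hid := mor_id HP').
assert (Hid' := proj2 HKC _ _ _ Hid).
apply (Hiv (u := w) (v := idmap (carrier P')) (f' := idmap (carrier P'))
         (A' := P') (B' := P')); trivial.
- apply Hw.
- split; [exact Hid'|]; exists (idmap (carrier P')).
  rewrite (comp_idmap_l (mor_func Hid')); auto.
Qed.

Section Objects.
Variables (A r M : V).
Hypothesis HL : is_signature L.
Hypothesis Hr : is_regular r.
Hypothesis Har : bounds_arities L r.
Hypothesis HLM : subset L M.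
Hypothesis HrM : subset r M.

(** A hull of p from which p can be recovered, up to equivalence, as a
pushout. *)
Definition is_hull_of S (p : pointed_arrow K A) (H : hull L S r A) : Prop :=
  (cod H = target p /\ arr H = arrow p /\ pt H = point p) /\
  obj C (trace H) /\
  pushout_maps_in K C (elems H) A (target p) (arrow p).

(** An arrow of K under A identifies the type of a point with the type of its
image: amalgamate over the codomain of q, with the identity on it. *)
Lemma galois_equiv_along (p q : pointed_arrow K A) w :
  mor K (target p) (target q) w -> comp w (arrow p) = arrow q ->
  app w (point p) = point q -> galois_equiv p q.
Proof.
intros Hw Ha Hp; apply rst_step.
assert (Hid := mor_id (proj1 (proj2 (mor_hom Hw)))).
exists (target q), w, (idmap (carrier (target q))); split; [|split; [|split]]; trivial.
- rewrite (comp_idmap_l (mor_func (arrow_mor q))); exact Ha.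
- rewrite (app_idmap (point_mem q)); exact Hp.
Qed.

(** The map k : P -> B induced by f and by the inclusion of N ∩ B sends the image
of b in P back to b. *)
Lemma galois_equiv_pushout S (p : pointed_arrow K A) (H : hull L S r A) P i j k
    (Hi : mor K A P i) (Hj : mor C (trace H) P j) (Hpt : app j (pt H) ∈ carrier P) :
  cod H = target p -> pt H = point p ->
  mor K P (target p) k -> comp k i = arrow p -> comp k j = incl (elems H) (target p) ->
  galois_equiv (PointedArrow Hi Hpt) p.
Proof.
intros EB Eb Hk Eki Ekj; apply galois_equiv_along with k; trivial; simpl.
assert (Htr : pt H ∈ carrier (trace H))
  by (apply in_carrier_trace; split; [apply pt_cod | apply pt_elems]).
rewrite <- (app_comp (mor_func Hj) (mor_func Hk) Htr), Ekj, <- Eb.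
apply app_idmap; rewrite <- EB; apply in_cap, in_carrier_trace, Htr.
Qed.

(** Both types are those of the images of the points in the pushouts, and these
correspond under the isomorphism of pushouts induced by the comparison map. *)
Lemma galois_equiv_of_agree S (p q : pointed_arrow K A) (G H : hull L S r A) :
  is_hull_of p G -> is_hull_of q H -> agree M G H -> galois_equiv p q.
Proof.
intros ((EB & Ef & Eb) & HG & HP) ((EB' & Ef' & Eb') & HH & HP') HGH.
destruct HP as (P & i & j & h & HP & _ & Ehi & Ehj & Hi & Hh).
destruct HP' as (P' & i' & j' & h' & HP' & _ & Ehi' & Ehj' & Hi' & Hh').
rewrite <- EB, <- Ef in HP; rewrite <- EB', <- Ef' in HP'.
fold (trace G) in HP; fold (trace H) in HP'.
assert (HGi := transfer_iso HL Hr Har HLM HrM HGH).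
assert (HHi := transfer_iso HL Hr Har HLM HrM (agree_sym HGH)).
assert (Einc : incl (elems G) A = incl (elems H) A)
  by (unfold incl; rewrite (agree_domain HGH); reflexivity).
rewrite <- Einc in HP'.
destruct (pushout_iso HP HP' (HC HG HH HGi) (HC HH HG HHi)
  (comp_transfer HGH) (comp_transfer (agree_sym HGH))
  (transfer_restrict HGH)) as (w & Hw & Ewi & Ewj).
assert (Hj : mor C (trace G) P j) by apply HP.
assert (Hj' : mor C (trace H) P' j') by apply HP'.
assert (Hpt : forall K : hull L S r A, pt K ∈ carrier (trace K))
  by (intro; apply in_carrier_trace; split; [apply pt_cod | apply pt_elems]).
set (p0 := PointedArrow Hi (app_in (mor_func Hj) (Hpt G))).
set (q0 := PointedArrow Hi' (app_in (mor_func Hj') (Hpt H))).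
apply rst_trans with p0; [apply rst_sym|apply rst_trans with q0].
- exact (galois_equiv_pushout Hi Hj _ EB Eb Hh Ehi Ehj).
- apply galois_equiv_along with w; simpl; [|exact Ewi|].
  + exact (iso_mor (proj1 (proj2 (mor_hom Hi'))) Hw).
  + rewrite <- (app_comp (mor_func Hj) (mor_func (proj1 Hw)) (Hpt G)), Ewj.
    rewrite (app_comp (transfer_func HGH) (mor_func Hj') (Hpt G)).
    rewrite (app_transfer_pt HGH); reflexivity.
- exact (galois_equiv_pushout Hi' Hj' _ EB' Eb' Hh' Ehi' Ehj').
Qed.

(** The enumeration of N may take values outside N; these are replaced by the
element L of N. *)
Lemma exists_hull k N (p : pointed_arrow K A) :
  is_ordinal k -> card_lt N k -> is_ar L r -> category_appropriate C N ->
  A ∈ N -> target p ∈ N -> arrow p ∈ N -> point p ∈ N ->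
  pushout_maps_in K C N A (target p) (arrow p) ->
  exists i, i ∈ k /\ exists H : hull L {z | z ∈ i} r A, is_hull_of p H.
Proof.
intros Hk HN Hra [(HLN & HLN' & _ & r' & Hr' & Hcl) Happ] HA HB Hf Hb HP.
rewrite (is_ar_unique Hr' Hra) in Hcl.
assert (Hfm := proj2 HKC _ _ _ (arrow_mor p)).
destruct (Happ A (target p) (arrow p)) as (_ & HoB & Hmf & _).
{ split; [|split; [|split]]; assumption. }
destruct (enumerated_of_card_lt Hk HN) as (i & Hi & F & HF).
exists i; split; [exact Hi|].
assert (Hin : forall s : {z | z ∈ i}, exists x, x ∈ N /\
  (F (proj1_sig s) ∈ N -> F (proj1_sig s) = x)).
{ intro s; destruct (classic (F (proj1_sig s) ∈ N)); [eauto|].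
  exists L; tauto. }
set (e s := proj1_sig (constructive_indefinite_description _ (Hin s))).
assert (He : forall s, e s ∈ N /\ (F (proj1_sig s) ∈ N -> F (proj1_sig s) = e s))
  by (intro s; exact (proj2_sig (constructive_indefinite_description _ (Hin s)))).
assert (Hon : forall z, z ∈ N -> exists s, e s = z).
{ intros z Hz; destruct (HF z Hz) as (j & Hj & <-); exists (exist _ j Hj).
  symmetry; exact (proj2 (He (exist _ j Hj)) Hz). }
assert (Hmf' := mor_func Hmf); rewrite !carrier_substructure in Hmf'.
exists (Hull (fun s => proj1 (He s)) Hon Hcl HLN (obj_structure (proj1 (proj2 (mor_hom Hfm))))
  (obj_structure HoB) (mor_func Hfm) Hmf' (point_mem p) Hb).
split; [auto|split; assumption].
Qed.

(** * Counting shapes *)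

(** The name of an index is the element that it denotes, if that lies in x.  The
relation between S and x with the same content could not be counted, because x
may have size λ and relations would then be as many as subsets of λ. *)
Definition names S (e : S -> V) x : S -> option {z | z ∈ x} :=
  fun s => match excluded_middle_informative (e s ∈ x) with
           | left H => Some (exist _ (e s) H)
           | right _ => None
           end.

Lemma names_eq S (e e' : S -> V) x : names e x = names e' x ->
  forall s z, z ∈ x -> e s = z -> e' s = z.
Proof.
intros E s z Hz Es; apply equal_f with (x := s) in E; unfold names in E.
rewrite <- Es in *; destruct (excluded_middle_informative (e s ∈ x)); [|tauto].
destruct (excluded_middle_informative (e' s ∈ x)); [|discriminate].
injection E; auto.
Qed.

Definition shape (S : Type) : Type :=
  (S -> S -> S -> atom -> Prop) *
  ((S -> option {z | z ∈ carrier A}) * (S -> option {z | z ∈ M})).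

Definition shape_of S (H : hull L S r A) : shape S :=
  (fun s u v q => holds (cod H) (arr H) (pt H) q (enum H s) (enum H u) (enum H v),
   (names (enum H) (carrier A), names (enum H) M)).

Lemma agree_of_shape S (G H : hull L S r A) :
  shape_of G = shape_of H -> agree M G H.
Proof.
intro E; injection E; intros EM EA Eq; split.
- intros q s u v.
  apply equal_f with (x := s) in Eq; apply equal_f with (x := u) in Eq.
  apply equal_f with (x := v) in Eq; apply equal_f with (x := q) in Eq.
  rewrite Eq; reflexivity.
- intros s x [Hx | Hx]; split; intro Es;
    [ exact (names_eq EA Hx Es) | exact (names_eq (eq_sym EA) Hx Es)
    | exact (names_eq EM Hx Es) | exact (names_eq (eq_sym EM) Hx Es) ].
Qed.

Lemma small_shape k l i : is_infinite_cardinal k -> is_infinite_cardinal l ->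
  card_le (lt_sequences l k) l -> i ∈ k ->
  card_le (carrier A) l -> card_le M l -> small l (shape {z | z ∈ i}).
Proof.
intros Hk Hl Hkl Hi HA HM; assert (HP := small_prop Hl).
unfold shape; repeat apply (small_prod Hk Hkl).
- do 3 apply (small_fun Hk Hkl Hi).
  refine (small_inj (F := fun Q : atom -> Prop =>
    (Q Same, (Q InCarrier, (Q Maps, (Q IsPoint, (Q Entry, (Q Interp, Q Graph)))))))
    _ _).
  + intros Q Q' E; injection E; intros; extensionality q; destruct q; assumption.
  + repeat apply (small_prod Hk Hkl); exact HP.
- apply (small_fun Hk Hkl Hi), (small_option Hk Hl Hkl), small_card_le, HA.
- apply (small_fun Hk Hkl Hi), (small_option Hk Hl Hkl), small_card_le, HM.
Qed.

Definition shaped k (p : pointed_arrow K A)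
    (c : {i : {i | i ∈ k} & shape {z | z ∈ proj1_sig i}}) : Prop :=
  exists H : hull L _ r A, is_hull_of p H /\ shape_of H = projT2 c.

Lemma galois_equiv_of_shaped k (p q : pointed_arrow K A)
    (c : {i : {i | i ∈ k} & shape {z | z ∈ proj1_sig i}}) :
  shaped p c -> shaped q c -> galois_equiv p q.
Proof.
intros (G & HG & EG) (H & HH & EH).
apply (galois_equiv_of_agree HG HH), agree_of_shape.
rewrite EG, EH; reflexivity.
Qed.

Lemma galois_equiv_eq (p q : pointed_arrow K A) :
  galois_equiv p q -> @galois_equiv V L K A p = galois_equiv q.
Proof.
intro Hpq; extensionality t; apply propositional_extensionality; split; intro H.
- apply rst_trans with p; [apply rst_sym|]; assumption.
- apply rst_trans with q; assumption.
Qed.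

End Objects.
End GaloisTypes.

Theorem theorem5p2 (V : universe) (L : V) (HL : is_signature L)
  (C K : subcategory L) (HKC : subcategory_of K C)
  (HC : contains_isos C)
  (kappa : V) (Hkappa : is_regular kappa) (Hunc : is_uncountable kappa)
  (HLkappa : card_lt L kappa)
  (Hpow : forall ar mu : V, is_ar L ar -> is_cardinal mu -> mu ∈ kappa ->
     card_lt (lt_sequences mu ar) kappa)
  (lambda : V) (Hlambda : is_cardinal lambda)
  (Hi : card_eq (lt_sequences lambda kappa) lambda)
  (Hii : USLS K lambda)
  (Hiii : lt_USLS_factoring C K kappa)
  (Hiv : arrows_closed_under_iso_in K C) :
  stable K lambda.
Proof.
intros A HA HAl.
destruct Hiii as (_ & Gam & [Hsize Hstat] & HLS & Hfac).
destruct Hkappa as [Hk _]; destruct Hii as [Hl _].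
assert (Hkl : card_le (lt_sequences lambda kappa) lambda)
  by (destruct Hi as (f & Hf & Hf' & _); exists f; auto).
assert (HAl' : card_le (carrier A) lambda)
  by (destruct HAl as (f & Hf & Hf' & _); exists f; auto).
(* The symbols and the ordinals below ar(L) lie in every appropriate set; any
   member of the stationary class can serve to name them. *)
destruct (Hstat (cup (upair A A) (upair A A)) (card_lt_four A A A A Hk))
  as (M & HM & _).
destruct (HLS M HM) as [(HLM & _ & _ & r & Hra & HMr) _].
assert (HrM : subset r M) by exact (closed_ordinals (proj1 Hra) HMr).
assert (HMl : card_le M lambda)
  by exact (card_le_trans (proj1 (Hsize M HM)) (card_le_base Hk Hl Hkl)).
destruct (small_sigT Hk Hkl (D := fun i => shape A M {z | z ∈ proj1_sig i})
  (small_card_le (card_le_base Hk Hl Hkl))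
  (fun i => small_shape Hk Hl Hkl (proj2_sig i) HAl' HMl)) as (F & HF & Fi).
assert (Hsh : forall p : pointed_arrow K A, exists c, shaped C r (M := M) (k := kappa) p c).
{ intro p.
  destruct (Hstat _ (card_lt_four A (target p) (arrow p) (point p) Hk))
    as (N & HN & HPN & _).
  assert (HNs : A ∈ N /\ target p ∈ N /\ arrow p ∈ N /\ point p ∈ N)
    by (repeat split; apply HPN; rewrite in_cup, !mem_upair; auto).
  destruct HNs as (HAN & HBN & HfN & HbN).
  destruct (exists_hull HKC (proj1 (proj1 Hk)) (Hsize N HN) Hra (HLS N HN)
    HAN HBN HfN HbN) as (i & Hik & H & HH).
  - apply (Hfac N HN); split; [exact (arrow_mor p) | auto].
  - exists (existT _ (exist _ i Hik) (shape_of M H)); exists H; auto. }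
(* A class gets the code of a shape of one of its members. *)
set (code_of T y := exists p c, T = @galois_equiv V L K A p /\
  shaped C r (M := M) (k := kappa) p c /\ y = F c).
exists (fun T => epsilon (inhabits empty) (code_of T)).
assert (Hcode : forall T, gS1 T -> code_of T (epsilon (inhabits empty) (code_of T))).
{ intros T [p ->]; apply epsilon_spec; destruct (Hsh p) as [c Hc].
  exists (F c), p, c; auto. }
split.
- intros T HT; destruct (Hcode T HT) as (p & c & _ & _ & ->); apply HF.
- intros T T' HT HT' E.
  destruct (Hcode T HT) as (p & c & -> & Hc & Ec).
  destruct (Hcode T' HT') as (p' & c' & -> & Hc' & Ec').
  rewrite Ec, Ec' in E; apply Fi in E; subst c'; apply galois_equiv_eq.
  destruct Hra as (Hr & Har & _).
  exact (galois_equiv_of_shaped HKC HC Hiv HL Hr Har HLM HrM Hc Hc').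
Qed.
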